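(* There exists a $\sigma$-Lebesgue Hausdorff locally convex-solid (real) vector lattice $(X,\tau)$ whose completion $(\hat X,\hat\tau)$ is not $\sigma$-Lebesgue.
   Context: A vector lattice is a real ordered vector space that is a lattice; $|x| = x\vee(-x)$. A subset $S$ of a vector lattice $X$ is solid if $[-|x|,|x|]\subseteq S$ for every $x\in S$. A linear topology on $X$ (one making addition and scalar multiplication continuous) is locally solid if $0$ has a neighbourhood basis of solid sets, and locally convex if $0$ has a neighbourhood basis of convex sets. A locally convex-solid topology is a linear topology that is both locally solid and locally convex; a vector lattice with such a topology is a locally convex-solid vector lattice. A locally solid vector lattice $(X,\tau)$ is $\sigma$-Lebesgue if for every decreasing sequence $(x_n)$ in $X$ with $\inf_n x_n = 0$ (infimum in $X$), one has $x_n\to 0$ with respect to $\tau$. The completion $(\hat X,\hat\tau)$ of a Hausdorff locally solid vector lattice $(X,\tau)$ is its completion as a Hausdorff topological vector space, equipped with the lattice operations obtained by extending the (uniformly continuous) lattice operations of $X$ by continuity; with this structure it is a Hausdorff locally solid vector lattice, containing $X$ as a dense vector sublattice. *)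

(* Defs.v *)
From HB Require Import structures.
From mathcomp Require Import all_boot all_order all_algebra.
From mathcomp Require Import boolp classical_sets functions.
From mathcomp Require Import reals topology convex normedtype sequences.

Set Implicit Arguments.
Unset Strict Implicit.
Unset Printing Implicit Defensive.

Import Order.TTheory GRing.Theory Num.Theory.
Import numFieldNormedType.Exports.

Local Open Scope classical_set_scope.
Local Open Scope ring_scope.

(* The order carries [ring_display], so that it is written [x <= y] in
   [ring_scope]. Joins and meets are specified exactly as in the library's
   [Order.Lattice], which cannot be inherited here: HB rejects a structure above
   both [Order.Lattice] and [GRing.Lmodule] because [Num.RealDomain] already
   inherits from order lattices and additive magmas without a declared join. *)
HB.mixin Record isVectorLattice (R : numDomainType) E
    & GRing.Lmodule R E & Order.POrder ring_display E := {
  vjoin : E -> E -> E ;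
  vmeet : E -> E -> E ;
  vjoin_le : forall x y z : E, (vjoin x y <= z) = (x <= z) && (y <= z) ;
  le_vmeet : forall x y z : E, (x <= vmeet y z) = (x <= y) && (x <= z) ;
  vlat_leD2r : forall z x y : E, x <= y -> x + z <= y + z ;
  vlat_scale_ge0 : forall (a : R) (x : E), 0 <= a -> 0 <= x -> 0 <= a *: x
}.

#[short(type="vectorLatticeType")]
HB.structure Definition VectorLattice (R : numDomainType) :=
  {E of isVectorLattice R E & GRing.Lmodule R E & Order.POrder ring_display E}.

Definition vlat_abs (R : numDomainType) (E : vectorLatticeType R) (x : E) : E :=
  vjoin x (- x).

Definition solid (R : numDomainType) (E : vectorLatticeType R) (S : set E) :=
  forall x, S x -> [set y | - vlat_abs x <= y <= vlat_abs x] `<=` S.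

#[short(type="topVectorLatticeType")]
HB.structure Definition TopVectorLattice (R : numDomainType) :=
  {E of VectorLattice R E & TopologicalLmodule R E}.

HB.mixin Record isLocallySolid (R : numDomainType) E
    & TopVectorLattice R E := {
  locally_solid : forall U : set E, nbhs 0 U ->
    exists V : set E, [/\ nbhs 0 V, solid V & V `<=` U]
}.

#[short(type="locallySolidType")]
HB.structure Definition LocallySolid (R : numDomainType) :=
  {E of isLocallySolid R E & TopVectorLattice R E}.

Definition is_locally_convex (R : numDomainType) (E : topologicalLmodType R) :=
  forall U : set E, nbhs 0 U ->
    exists V : set E,
      [/\ nbhs 0 V, convex_set (V : set (convex_lmodType E)) & V `<=` U].

Definition sigma_lebesgue (R : numDomainType) (E : locallySolidType R) :=
  forall x : nat -> E,
    nonincreasing_seq x -> infimums (range x) 0 -> x @ \oo --> (0 : E).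

(* Cauchy filters and completeness for the canonical uniformity of a
   topological vector space. The library's [cauchy] is not used because the
   entourages of [tvsType] are not required to be translation invariant, and
   [UniformLmodule] demands that scaling be jointly uniformly continuous, which
   fails for nonzero spaces. *)
Definition tvs_cauchy (R : numDomainType) (E : topologicalLmodType R)
    (F : set_system E) :=
  (fun z : E * E => z.1 - z.2) @ (F, F) --> (0 : E).

Definition tvs_complete (R : numDomainType) (E : topologicalLmodType R) :=
  forall F : set_system E, ProperFilter F -> tvs_cauchy F ->
    exists l : E, F --> l.

(* [i : X -> Y] exhibits [Y] as the completion of [X]: [Y] is a complete
   Hausdorff topological vector space, [i] is a linear topological embedding
   with dense range, and the lattice operations of [Y] are the (unique)
   continuous extensions of those of [X]. *)
Record is_completion (R : numDomainType) (X Y : locallySolidType R)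
    (i : {linear X -> Y}) : Prop := IsCompletion {
  completion_hausdorff : hausdorff_space Y ;
  completion_complete : tvs_complete Y ;
  completion_inj : injective i ;
  completion_open : forall U : set X,
    open U <-> exists2 V : set Y, open V & i @^-1` V = U ;
  completion_dense : dense (range i) ;
  completion_join : forall x y : X,
    i (vjoin x y) = vjoin (i x) (i y) ;
  completion_meet : forall x y : X,
    i (vmeet x y) = vmeet (i x) (i y) ;
  completion_join_continuous :
    continuous (fun z : Y * Y => vjoin z.1 z.2) ;
  completion_meet_continuous :
    continuous (fun z : Y * Y => vmeet z.1 z.2)
}.

(* Main.v *)
(** Let T be the disjoint union of nat and the uncountable set nat -> nat, and let
    X be the functions on T that are constant off a finite set, with the topology
    of uniform convergence on nat and pointwise convergence elsewhere.

    X is sigma-Lebesgue: if x_n decreases to 0 in X, then x_n -> 0 pointwise,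
    since X contains the multiples of all point indicators. As the exceptional
    sets of all the x_n together are countable, some point p of T avoids them, so
    the generic value of x_n is x_n(p), which tends to 0; together with pointwise
    convergence on one finite exceptional set this makes x_n uniformly small.

    In the completion, the value at infinity on nat is no longer tied to the
    values on nat -> nat, so the indicators of the tails [n, oo) of nat belong
    to it; they decrease to 0 but have norm 1 on nat. *)

From HB Require Import structures.
Require Import Defs.
From mathcomp Require Import all_boot all_order all_algebra.
From mathcomp Require Import boolp classical_sets functions.
From mathcomp Require Import reals topology convex normedtype sequences.
From mathcomp Require Import unstable interval_inference ring lra.

Set Implicit Arguments.
Unset Strict Implicit.
Unset Printing Implicit Defensive.

Import Order.TTheory GRing.Theory Num.Theory.
Import numFieldNormedType.Exports.

Local Open Scope classical_set_scope.
Local Open Scope ring_scope.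

(** * Vector lattices of real functions on a set *)

Lemma ltr_dist_max (R : realDomainType) (a b c d e : R) :
  `|a - c| < e -> `|b - d| < e -> `|Num.max a b - Num.max c d| < e.
Proof. by rewrite !ltr_norml => *; case: (leP a b); case: (leP c d); lra. Qed.

Lemma ltr_dist_min (R : realDomainType) (a b c d e : R) :
  `|a - c| < e -> `|b - d| < e -> `|Num.min a b - Num.min c d| < e.
Proof. by rewrite !ltr_norml => *; case: (leP a b); case: (leP c d); lra. Qed.

(** Minima come from maxima and negation by duality. Boundedness on [B] is what makes scalar
    multiplication continuous for uniform convergence on [B]. *)
Record function_lattice (R : realType) (T : choiceType) (B : set T) :=
  FunctionLattice {
  fl_mem :> (T -> R) -> Prop ;
  fl_zero : fl_mem (fun=> 0) ;
  fl_linear : forall a f g,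
    fl_mem f -> fl_mem g -> fl_mem (fun t => a * f t + g t) ;
  fl_max : forall f g,
    fl_mem f -> fl_mem g -> fl_mem (fun t => Num.max (f t) (g t)) ;
  fl_bounded : forall f, fl_mem f -> exists M, forall t, B t -> `|f t| <= M
}.

Section FunctionLattice.
Variables (R : realType) (T : choiceType) (B : set T).
Variable V : function_lattice R B.

Definition fl_pred : {pred T -> R} := [pred f | `[< V f >]].

Lemma fl_submod_closed : submod_closed fl_pred.
Proof.
split=> [|a f g]; first by apply/asboolP; exact: fl_zero.
by move=> /asboolP Vf /asboolP Vg; apply/asboolP; exact: fl_linear.
Qed.

Definition fl_type := {f : T -> R | f \in fl_pred}.

HB.instance Definition _ := SubChoice.on fl_type.
HB.instance Definition _ :=
  GRing.SubChoice_isSubLmodule.Build R (T -> R) fl_pred fl_type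
  (GRing.submod_closed_semi fl_submod_closed).

Implicit Types f g h : fl_type.

Definition fl_fun f : T -> R := \val f.
Coercion fl_fun : fl_type >-> Funclass.

Lemma fl_funP f : V f.
Proof. exact/asboolP/(valP f). Qed.

Definition fl_of (f : T -> R) (Vf : V f) : fl_type :=
  exist _ f (introT (asboolP _) Vf).

Lemma fl_ext f g : (forall t, f t = g t) -> f = g.
Proof. by move=> fg; apply: val_inj; apply/funext. Qed.

Lemma fl_zeroE t : fl_fun 0 t = 0.
Proof. by rewrite /fl_fun raddf0. Qed.

Lemma fl_addE f g t : fl_fun (f + g) t = f t + g t.
Proof. by rewrite /fl_fun raddfD. Qed.

Lemma fl_oppE f t : fl_fun (- f) t = - f t.
Proof. by rewrite /fl_fun raddfN. Qed.

Lemma fl_scaleE (a : R) f t : fl_fun (a *: f) t = a * f t.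
Proof. by []. Qed.

Definition fl_le f g := `[< forall t, f t <= g t >].

Lemma fl_le_refl : reflexive fl_le.
Proof. by move=> f; apply/asboolP. Qed.

Lemma fl_le_anti : antisymmetric fl_le.
Proof.
move=> f g /andP[/asboolP fg /asboolP gf]; apply: fl_ext => t.
by apply/eqP; rewrite eq_le fg gf.
Qed.

Lemma fl_le_trans : transitive fl_le.
Proof.
move=> g f h /asboolP fg /asboolP gh; apply/asboolP => t.
exact: le_trans (fg t) (gh t).
Qed.

HB.instance Definition _ := Order.Le_isPOrder.Build ring_display fl_type
  fl_le_refl fl_le_anti fl_le_trans.

Lemma fl_leP f g : reflect (forall t, f t <= g t) (f <= g).
Proof. exact: asboolP. Qed.

Definition fl_join f g : fl_type := fl_of (fl_max (fl_funP f) (fl_funP g)).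

Definition fl_meet f g : fl_type := - fl_join (- f) (- g).

Lemma fl_joinE f g t : fl_join f g t = Num.max (f t) (g t).
Proof. by []. Qed.

Lemma fl_meetE f g t : fl_meet f g t = Num.min (f t) (g t).
Proof. by rewrite /fl_meet fl_oppE fl_joinE !fl_oppE oppr_max !opprK. Qed.

Lemma fl_join_le f g h : (fl_join f g <= h) = (f <= h) && (g <= h).
Proof.
apply/fl_leP/andP => [fgh|[/fl_leP fh /fl_leP gh] t]; last first.
  by rewrite fl_joinE ge_max fh gh.
by split; apply/fl_leP => t; move: (fgh t); rewrite fl_joinE ge_max => /andP[].
Qed.

Lemma fl_le_meet f g h : (f <= fl_meet g h) = (f <= g) && (f <= h).
Proof.
apply/fl_leP/andP => [fgh|[/fl_leP fh /fl_leP gh] t]; last first.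
  by rewrite fl_meetE le_min fh gh.
by split; apply/fl_leP => t; move: (fgh t); rewrite fl_meetE le_min => /andP[].
Qed.

Lemma fl_leD2r h f g : f <= g -> f + h <= g + h.
Proof.
by move=> /fl_leP fg; apply/fl_leP => t; rewrite !fl_addE lerD2r.
Qed.

Lemma fl_scale_ge0 (a : R) f : 0 <= a -> 0 <= f -> 0 <= a *: f.
Proof.
move=> a0 /fl_leP f0; apply/fl_leP => t.
by rewrite fl_scaleE; move: (f0 t); rewrite fl_zeroE; exact: mulr_ge0.
Qed.

HB.instance Definition _ := isVectorLattice.Build R fl_type
  fl_join_le fl_le_meet fl_leD2r fl_scale_ge0.

(** * The topology of uniform convergence on B and pointwise convergence elsewhere *)

Definition fl_ball (F : seq T) (e : R) f : set fl_type :=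
  [set g | forall t, B t \/ t \in F -> `|f t - g t| < e].

Definition fl_nbhs f : set_system fl_type :=
  [set U | exists F e, 0 < e /\ fl_ball F e f `<=` U].

HB.instance Definition _ := hasNbhs.Build fl_type fl_nbhs.

Lemma fl_nbhsP f (U : set fl_type) :
  nbhs f U <-> exists F e, 0 < e /\ fl_ball F e f `<=` U.
Proof. by []. Qed.

Lemma fl_ball_center F e f : 0 < e -> fl_ball F e f f.
Proof. by move=> e0 t _; rewrite subrr normr0. Qed.

Lemma nbhs_fl_ball F e f : 0 < e -> nbhs f (fl_ball F e f).
Proof. by move=> e0; apply/fl_nbhsP; exists F, e; split. Qed.

Lemma fl_nbhs_filter f : ProperFilter (nbhs f).
Proof.
apply: Build_ProperFilter_ex => [U /fl_nbhsP[F [e [e0 sU]]]|].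
  by exists f; exact/sU/fl_ball_center.
split=> [|U U' [F [e [e0 sU]]] [F' [e' [e'0 sU']]]|U U' UU' [F [e [e0 sU]]]].
- by apply/fl_nbhsP; exists [::], 1; split.
- apply/fl_nbhsP; exists (F ++ F'), (Num.min e e'); split.
    by rewrite lt_min e0.
  move=> g fg; split; [apply: sU | apply: sU'] => t tF.
  + have /fg : B t \/ t \in F ++ F'.
      by case: tF => [Bt|tF]; [left | right; rewrite mem_cat tF].
    by rewrite lt_min => /andP[].
  + have /fg : B t \/ t \in F ++ F'.
      by case: tF => [Bt|tF]; [left | right; rewrite mem_cat tF orbT].
    by rewrite lt_min => /andP[].
- by apply/fl_nbhsP; exists F, e; split => // g /sU/UU'.
Qed.

Lemma fl_nbhs_singleton f (U : set fl_type) : nbhs f U -> U f.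
Proof. by move=> /fl_nbhsP[F [e [e0 sU]]]; exact/sU/fl_ball_center. Qed.

Lemma fl_ball_triangle F e e' f g h :
  fl_ball F e f g -> fl_ball F e' g h -> fl_ball F (e + e') f h.
Proof.
move=> fg gh t tF; rewrite -(subrKA (g t)).
by rewrite (le_lt_trans (ler_normD _ _))// ltrD ?fg ?gh.
Qed.

(** A [fl_ball] need not be open: a strict inequality at each point of an infinite [B] still allows
    a supremum equal to [e]. Hence the passage to half the radius. *)
Lemma fl_nbhs_nbhs f (U : set fl_type) : nbhs f U -> nbhs f (nbhs^~ U).
Proof.
move=> /fl_nbhsP[F [e [e0 sU]]]; apply/fl_nbhsP; exists F, (e / 2).
split; first by rewrite divr_gt0.
move=> g fg; apply/fl_nbhsP; exists F, (e / 2).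
split=> [|h gh]; first by rewrite divr_gt0.
by apply: sU; rewrite [e]splitr; exact: fl_ball_triangle gh.
Qed.

HB.instance Definition _ := Nbhs_isNbhsTopological.Build fl_type
  fl_nbhs_filter fl_nbhs_singleton fl_nbhs_nbhs.

(** The same finite set [F] serves for the arguments and for the value, as the operations in
    question act pointwise. *)
Lemma fl_continuous2P (phi : fl_type -> fl_type -> fl_type) :
  (forall f g F e, 0 < e -> exists2 d, 0 < d &
    forall f' g', fl_ball F d f f' -> fl_ball F d g g' ->
      fl_ball F e (phi f g) (phi f' g')) ->
  continuous (fun z : fl_type * fl_type => phi z.1 z.2).
Proof.
move=> phiP [f g] U /fl_nbhsP[F [e [e0 sU]]].
have [d d0 phid] := phiP f g F e e0.
exists (fl_ball F d f, fl_ball F d g); first by split; exact: nbhs_fl_ball.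
by move=> [f' g'] [/= ff' gg']; apply: sU; exact: phid.
Qed.

Lemma fl_add_continuous : continuous (fun z : fl_type * fl_type => z.1 + z.2).
Proof.
apply: fl_continuous2P => f g F e e0.
exists (e / 2) => [|f' g' ff' gg' t tF]; first by rewrite divr_gt0.
rewrite !fl_addE opprD addrACA [e]splitr (le_lt_trans (ler_normD _ _))//.
by rewrite ltrD ?ff' ?gg'.
Qed.

Lemma fl_bounded_seq f (F : seq T) :
  exists2 M, 0 < M & forall t, B t \/ t \in F -> `|f t| < M.
Proof.
have [M BM] := fl_bounded (fl_funP f).
(* The sum dominates each value on [F], and the 1 gives positivity and strictness. The absolute
   value is taken since [M] may be negative when [B] is empty. *)
exists (`|M| + \sum_(s <- F) `|f s| + 1) => [|t].
  by rewrite ltr_wpDl// addr_ge0// sumr_ge0.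
move=> tF; rewrite ltr_pwDr//; case: tF => [/BM Bt|tF].
  by rewrite (le_trans Bt)// (le_trans (ler_norm _))// lerDl sumr_ge0.
by rewrite (big_rem t)//= addrCA lerDl addr_ge0// sumr_ge0.
Qed.

Lemma fl_scale_continuous :
  continuous (fun z : R^o * fl_type => z.1 *: z.2).
Proof.
move=> [a f] U /fl_nbhsP[F [e [e0 sU]]].
have [M M0 fM] := fl_bounded_seq f F.
have a0 : 0 < `|a| + 1 by rewrite ltr_wpDl.
(* The radii suit the splitting a f - b g = (a - b) f + b (f - g): each term is below e / 2, using
   |f| < M in the first and |b| <= |a| + 1, from |a - b| < 1, in the second. *)
pose d := Num.min 1 (e / 2 / (`|a| + 1)).
exists (ball (a : R^o) (Num.min 1 (e / 2 / M)), fl_ball F d f).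
  split; last by apply: nbhs_fl_ball; rewrite lt_min ltr01 !divr_gt0.
  by apply: nbhsx_ballx; rewrite lt_min ltr01 !divr_gt0.
move=> [b g] [/= ab fg]; apply: sU => t tF; rewrite !fl_scaleE.
move: ab; rewrite -ball_normE /= lt_min => /andP[ab1 abM].
move: (fg t tF); rewrite lt_min => /andP[_ fgd].
rewrite (_ : _ - _ = (a - b) * fl_fun f t + b * (fl_fun f t - fl_fun g t));
  last by ring.
rewrite [e]splitr (le_lt_trans (ler_normD _ _))// !normrM ltrD//.
  move: abM; rewrite ltr_pdivlMr//; apply: le_lt_trans.
  by rewrite ler_wpM2l// ltW// fM.
move: fgd; rewrite ltr_pdivlMr// mulrC; apply: le_lt_trans.
rewrite ler_wpM2r//; have := ler_distD 0 b a; rewrite !subr0 sub0r normrN.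
have := ler_normB a (a - b); rewrite subKr; move: (ltW ab1); lra.
Qed.

HB.instance Definition _ :=
  PreTopologicalNmodule_isTopologicalNmodule.Build fl_type fl_add_continuous.
HB.instance Definition _ :=
  TopologicalNmodule_isTopologicalLmodule.Build R fl_type fl_scale_continuous.

(** * Solidity, convexity, separation and continuity of the lattice operations *)

Lemma fl_absE f t : fl_fun (vlat_abs f) t = `|f t|.
Proof.
rewrite /vlat_abs [LHS]fl_joinE fl_oppE; case: (leP 0 (f t)) => ft0.
  by rewrite ger0_norm// max_l//; lra.
by rewrite ltr0_norm// max_r//; lra.
Qed.

Lemma fl_ball_solid F e : solid (fl_ball F e 0).
Proof.
move=> f f0 g /= /andP[/fl_leP gf /fl_leP fg] t tF.
move: (f0 t tF) (gf t) (fg t); rewrite fl_oppE !fl_absE fl_zeroE !sub0r !normrN.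
by move=> fe ? ?; apply: le_lt_trans fe; rewrite ler_norml; apply/andP.
Qed.

Lemma fl_locally_solid (U : set fl_type) : nbhs 0 U ->
  exists W : set fl_type, [/\ nbhs 0 W, solid W & W `<=` U].
Proof.
move=> /fl_nbhsP[F [e [e0 sU]]]; exists (fl_ball F e 0); split=> //.
- exact: nbhs_fl_ball.
- exact: fl_ball_solid.
Qed.

HB.instance Definition _ := isLocallySolid.Build R fl_type fl_locally_solid.

Lemma fl_locally_convex : is_locally_convex fl_type.
Proof.
move=> U /fl_nbhsP[F [e [e0 sU]]]; exists (fl_ball F e 0); split=> //.
  exact: nbhs_fl_ball.
apply/convex_setW => f g /set_mem f0 /set_mem g0 k k0 k1; apply/mem_set => t tF.
move: (f0 t tF) (g0 t tF).
rewrite fl_addE !fl_scaleE fl_zeroE !sub0r !normrN => fe ge.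
rewrite (le_lt_trans (ler_normD _ _))// !normrM (gtr0_norm k0).
rewrite [`|onem _|]gtr0_norm ?onem_gt0//.
(* Writing e as k e + (1 - k) e lets the two terms be compared separately. *)
rewrite -[ltRHS]mul1r -(add_onemK k%:num) [ltRHS]mulrDl.
by rewrite ltrD// ltr_pM2l// onem_gt0.
Qed.

Lemma fl_hausdorff : hausdorff_space fl_type.
Proof.
move=> f g fg; apply: fl_ext => t; apply/eqP/contraT => ft.
have e0 : 0 < `|fl_fun f t - fl_fun g t| / 2.
  by rewrite divr_gt0// normr_gt0 subr_eq0.
have [h [fh gh]] := fg _ _ (nbhs_fl_ball [:: t] f e0) (nbhs_fl_ball [:: t] g e0).
have := fh t; have := gh t; rewrite mem_head => /(_ (or_intror isT)) ght.
move=> /(_ (or_intror isT)) fht.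
have := ler_distD (fl_fun h t) (fl_fun f t) (fl_fun g t).
rewrite (distrC (fl_fun h t)); lra.
Qed.

Lemma fl_join_continuous :
  continuous (fun z : fl_type * fl_type => vjoin z.1 z.2).
Proof.
apply: fl_continuous2P => f g F e e0; exists e => // f' g' ff' gg' t tF.
by rewrite !fl_joinE ltr_dist_max ?ff' ?gg'.
Qed.

Lemma fl_meet_continuous :
  continuous (fun z : fl_type * fl_type => vmeet z.1 z.2).
Proof.
apply: fl_continuous2P => f g F e e0; exists e => // f' g' ff' gg' t tF.
by rewrite !fl_meetE ltr_dist_min ?ff' ?gg'.
Qed.

End FunctionLattice.

(** * The closure among all functions as a model of the completion *)

Section Closure.
Variables (R : realType) (T : choiceType) (B : set T).
Variable V : function_lattice R B.

(** Closure is spelled out by approximation, because the topology above is only set up on function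
    lattices: on functions unbounded on [B], scaling would not be continuous. *)
Definition closure_mem (f : T -> R) := forall (F : seq T) e, 0 < e ->
  exists2 g, V g & forall t, B t \/ t \in F -> `|f t - g t| < e.

Lemma sub_closure_mem f : V f -> closure_mem f.
Proof. by move=> Vf F e e0; exists f => // t _; rewrite subrr normr0. Qed.

Lemma closure_linear a f g :
  closure_mem f -> closure_mem g -> closure_mem (fun t => a * f t + g t).
Proof.
move=> cf cg F e e0; have a0 : 0 < `|a| + 1 by rewrite ltr_wpDl.
have [|f' Vf' ff'] := cf F (e / 2 / (`|a| + 1)); first by rewrite !divr_gt0.
have [|g' Vg' gg'] := cg F (e / 2); first by rewrite divr_gt0.
exists (fun t => a * f' t + g' t) => [|t tF]; first exact: fl_linear.
rewrite opprD addrACA -mulrBr [e]splitr (le_lt_trans (ler_normD _ _))// normrM.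
rewrite ltrD ?gg'//; move: (ff' t tF); rewrite ltr_pdivlMr//.
by apply: le_lt_trans; rewrite mulrC ler_wpM2l// lerDl.
Qed.

Lemma closure_max f g : closure_mem f -> closure_mem g ->
  closure_mem (fun t => Num.max (f t) (g t)).
Proof.
move=> cf cg F e e0; have [f' Vf' ff'] := cf F e e0.
have [g' Vg' gg'] := cg F e e0.
exists (fun t => Num.max (f' t) (g' t)) => [|t tF]; first exact: fl_max.
by rewrite ltr_dist_max ?ff' ?gg'.
Qed.

Lemma closure_bounded f : closure_mem f -> exists M, forall t, B t -> `|f t| <= M.
Proof.
move=> /(_ [::] 1 ltr01)[g Vg fg]; have [M gM] := fl_bounded Vg.
exists (1 + M) => t Bt; rewrite -[f t](subrK (g t)).
by rewrite (le_trans (ler_normD _ _))// lerD ?gM// ltW// fg//; left.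
Qed.

(** Being a function lattice over the same [B], the closure receives its order and topology from the
    general construction. *)
Definition closure_fl := FunctionLattice (sub_closure_mem (fl_zero V))
  closure_linear closure_max closure_bounded.

Let E := fl_type V.
Let Ehat := fl_type closure_fl.

(** Completeness of the reals gives a pointwise limit [l]. The Cauchy estimates are uniform on [B]
    and survive the pointwise limit, so [l] is approximated by members of the closure, hence by
    members of [V], and the filter converges to it. *)
Lemma closure_complete : tvs_complete Ehat.
Proof.
move=> F PF Fcauchy.
(* The Cauchy condition yields large sets P and Q with P - Q inside the ball at 0; the ball around
   any f in P then contains Q. *)
have ballF D e : 0 < e -> exists f, F (fl_ball D e f).
  move=> /(nbhs_fl_ball D 0) /Fcauchy [[P Q] [/= FP FQ] PQ].
  have [f Pf] := filter_ex FP; exists f; apply: filterS FQ => g Qg t tD.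
  have := PQ (f, g) (conj Pf Qg) t tD.
  by rewrite fl_addE fl_oppE fl_zeroE sub0r normrN.
have cvgF t : exists l : R, (fun f : Ehat => fl_fun f t) @ F --> l.
  suff : cvg ((fun f : Ehat => fl_fun f t) @ F) by move=> /cvg_ex.
  apply/cauchy_cvgP/cauchy_exP => e e0; have [f Ff] := ballF [:: t] e e0.
  exists (fl_fun f t); suff : F [set g | ball (fl_fun f t) e (fl_fun g t)] by [].
  apply: filterS Ff => g fg.
  by rewrite -ball_normE; apply: fg; right; exact: mem_head.
have [l lP] := choice cvgF.
(* For each t, some g in the ball has g t within d of l t. This g depends on t but the bound e + d
   does not; letting d tend to 0 makes the inequality weak. *)
have ball_lim D e f : F (fl_ball D e f) ->
    forall t, B t \/ t \in D -> `|fl_fun f t - l t| <= e.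
  move=> Ff t tD; apply/ler_addgt0Pr => d d0.
  have Fl : F [set g | ball (l t) d (fl_fun g t)] := lP t _ (nbhsx_ballx _ _ d0).
  have [g [fg gl]] := filter_ex (filterI Ff Fl).
  move: gl; rewrite /= -ball_normE /= distrC => gl.
  by rewrite (le_trans (ler_distD (fl_fun g t) _ _))// lerD// ltW// fg.
have cl : closure_fl l.
  move=> D e e0; have [|f Ff] := ballF D (e / 3); first by rewrite divr_gt0.
  have [|g Vg fg] := (fl_funP f : closure_mem _) D (e / 3).
    by rewrite divr_gt0.
  exists g => // t tD; have := ler_distD (fl_fun f t) (l t) (g t).
  have := ball_lim _ _ _ Ff t tD; have := fg t tD.
  rewrite (distrC (l t) (fl_fun f t)); lra.
exists (fl_of cl) => U /fl_nbhsP[D [e [e0 sU]]].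
have [|f Ff] := ballF D (e / 3); first by rewrite divr_gt0.
apply: (filterS _ Ff) => g fg; apply: sU => t tD.
have := ler_distD (fl_fun f t) (l t) (fl_fun g t); have := fg t tD.
have := ball_lim _ _ _ Ff t tD; rewrite (distrC (l t) (fl_fun f t)) /=; lra.
Qed.

Definition fl_incl (f : E) : Ehat :=
  fl_of (V := closure_fl) (sub_closure_mem (fl_funP f)).

Lemma fl_incl_linear : linear fl_incl.
Proof. by move=> a f g; apply: fl_ext => t. Qed.

HB.instance Definition _ :=
  GRing.isLinear.Build R E Ehat *:%R fl_incl fl_incl_linear.

Lemma fl_incl_ball D e f g :
  fl_ball D e (fl_incl f) (fl_incl g) = fl_ball D e f g.
Proof. by []. Qed.

Lemma fl_incl_completion : is_completion fl_incl.
Proof.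
split.
- exact: fl_hausdorff.
- exact: closure_complete.
- by move=> f g fg; apply: fl_ext => t; have := congr1 (fun h => fl_fun h t) fg.
- move=> U; split=> [oU|[W oW <-]].
    (* This is the largest open set whose trace on [E] lies in [U]. The trace is all of [U] because
       balls of [E] are traces of balls of [Ehat]. *)
    exists (~` (fl_incl @` (~` U)))°; first exact: open_interior.
    apply/seteqP; split=> f /=.
      by move=> /nbhs_singleton /= nf; apply: contrapT => Uf; apply: nf; exists f.
    move: oU; rewrite openE => /[apply] /fl_nbhsP[D [e [e0 sU]]].
    apply/fl_nbhsP; exists D, e; split=> // h fh [g Ug gh]; apply/Ug/sU.
    by rewrite -fl_incl_ball gh.
  move: oW; rewrite !openE => oW f /oW /fl_nbhsP[D [e [e0 sW]]].
  by apply/fl_nbhsP; exists D, e; split=> // g fg; exact: sW.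
- move=> O [f Of]; rewrite openE => /(_ _ Of) /fl_nbhsP[D [e [e0 sO]]].
  have [g Vg fg] := (fl_funP f : closure_mem _) D e e0.
  by exists (fl_incl (fl_of Vg)); split; [exact: sO | exists (fl_of Vg)].
- by move=> f g; apply: fl_ext.
- by move=> f g; apply: fl_ext => t; rewrite [RHS]fl_meetE -[RHS](@fl_meetE _ _ _ V).
- exact: fl_join_continuous.
- exact: fl_meet_continuous.
Qed.

End Closure.

(** * The lattice of almost constant functions and its completion *)

Section Counterexample.
Variable R : realType.

Let T : choiceType := (nat + (nat -> nat))%type.
Let B : set T := range inl.

Definition almost_constant (f : T -> R) :=
  exists c (s : seq T), forall t, t \notin s -> f t = c.

Lemma almost_constant0 : almost_constant (fun=> 0).
Proof. by exists 0, [::]. Qed.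

Lemma almost_constant_linear a f g : almost_constant f -> almost_constant g ->
  almost_constant (fun t => a * f t + g t).
Proof.
move=> [c [s fc]] [d [s' gd]]; exists (a * c + d), (s ++ s') => t.
by rewrite mem_cat negb_or => /andP[/fc-> /gd->].
Qed.

Lemma almost_constant_max f g : almost_constant f -> almost_constant g ->
  almost_constant (fun t => Num.max (f t) (g t)).
Proof.
move=> [c [s fc]] [d [s' gd]]; exists (Num.max c d), (s ++ s') => t.
by rewrite mem_cat negb_or => /andP[/fc-> /gd->].
Qed.

Lemma almost_constant_bounded f :
  almost_constant f -> exists M, forall t, B t -> `|f t| <= M.
Proof.
move=> [c [s fc]]; exists (`|c| + \sum_(t <- s) `|f t|) => t _.
have [ts|/fc->] := boolP (t \in s); last by rewrite lerDl sumr_ge0.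
by rewrite (big_rem t)//= addrCA lerDl addr_ge0// sumr_ge0.
Qed.

Definition almost_constant_fl := FunctionLattice almost_constant0
  almost_constant_linear almost_constant_max almost_constant_bounded.

Let X := fl_type almost_constant_fl.
Let Xhat := fl_type (closure_fl almost_constant_fl).

(** Cantor's diagonal argument: p n is one more than the sum of the values q n over the points
    [inr q] of [s n], so p differs at n from each such q. *)
Lemma diagonal (s : nat -> seq T) : exists p, forall n, inr p \notin s n.
Proof.
pose v (t : T) n := if t is inr q then q n else 0%N.
exists (fun n => (\sum_(t <- s n) v t n).+1) => n; apply/negP => ps.
have : (v (inr (fun n => (\sum_(t <- s n) v t n).+1)) n <= \sum_(t <- s n) v t n)%N.
  by rewrite (big_rem _ ps) leq_addr.
by rewrite {1}/v ltnn.
Qed.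

Lemma almost_constant_spike (s : T) (e : R) :
  almost_constant (fun t => if t == s then e else 0).
Proof. by exists 0, [:: s] => t; rewrite inE => /negbTE->. Qed.

(** Otherwise the spike of height e at t, which belongs to [X], would be a lower bound not below
    0. *)
Lemma inf0_pointwise (x : nat -> X) : infimums (range x) 0 ->
  forall t e, 0 < e -> exists n, fl_fun (x n) t < e.
Proof.
move=> [x0 lbx] s e e0; apply: contrapT => /forallNP xe.
pose d : X := fl_of (almost_constant_spike s e : almost_constant_fl _).
have /lbx/fl_leP/(_ s) : lbound (range x) d.
  move=> _ [n _ <-]; apply/fl_leP => t; rewrite /d /=.
  rewrite /fl_fun /=; case: eqP => [->|_]; first by rewrite leNgt; apply/negP/xe.
  have /fl_leP/(_ t) : 0 <= x n by apply: x0; exists n.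
  by rewrite fl_zeroE.
by rewrite fl_zeroE /d /fl_fun /= eqxx leNgt e0.
Qed.

Lemma almost_constant_sigma_lebesgue : sigma_lebesgue X.
Proof.
move=> x x_dec x_inf.
have x_ge0 n t : 0 <= fl_fun (x n) t.
  have /fl_leP/(_ t) : 0 <= x n by apply: x_inf.1; exists n.
  by rewrite fl_zeroE.
have x_le m n t : (m <= n)%N -> fl_fun (x n) t <= fl_fun (x m) t.
  by move=> /x_dec/fl_leP.
have [c cP] := choice (fun n => fl_funP (x n)).
have [s xc] := choice cP.
have [p ps] := diagonal s.
have small e : 0 < e -> exists n, forall t, fl_fun (x n) t < e.
  (* Since p avoids [s m], the generic value of x m is its value at p. Making it smaller than e
     controls every later term off [s m], and only the finite set [s m] remains. *)
  move=> e0; have [m xm] := inf0_pointwise x_inf (inr p) e0.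
  have small_s (r : seq T) : exists n, forall t, t \in r -> fl_fun (x n) t < e.
    elim: r => [|t r [n xn]]; first by exists 0%N.
    have [k xk] := inf0_pointwise x_inf t e0.
    exists (maxn k n) => u; rewrite inE => /orP[/eqP->|ur].
      exact: le_lt_trans (x_le _ _ _ (leq_maxl _ _)) xk.
    exact: le_lt_trans (x_le _ _ _ (leq_maxr _ _)) (xn u ur).
  have [n xn] := small_s (s m); exists (maxn m n) => t.
  have [ts|ts] := boolP (t \in s m).
    exact: le_lt_trans (x_le _ _ _ (leq_maxr _ _)) (xn t ts).
  apply: le_lt_trans (x_le _ _ _ (leq_maxl _ _)) _.
  by rewrite (xc _ _ ts) -(xc _ _ (ps m)).
move=> U /fl_nbhsP[D [e [e0 sU]]]; have [n xn] := small e e0.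
exists n => // k /= nk; apply: sU => t _.
rewrite fl_zeroE sub0r normrN ger0_norm//.
exact: le_lt_trans (x_le _ _ _ nk) (xn t).
Qed.

Definition tail_indicator (n : nat) (t : T) : R :=
  if t is inl k then (n <= k)%:R else 0.

(** The approximant keeps the values on the first n naturals and on [F], and is 1 elsewhere. It thus
    agrees exactly with the indicator on [nat] and [F], and errs only at points of [nat -> nat]
    outside [F]. *)
Lemma closure_tail n : closure_fl almost_constant_fl (tail_indicator n).
Proof.
move=> F e e0; pose s : seq T := map inl (iota 0 n) ++ F.
exists (fun t => if t \in s then tail_indicator n t else 1).
  by exists 1, s => t /negbTE->.
move=> t tF; case: ifPn => [_|]; first by rewrite subrr normr0.
rewrite mem_cat negb_or => /andP[ts tNF].
case: tF => [[k _ tk]|]; last by rewrite (negbTE tNF).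
move: ts; rewrite -tk mem_map; last by move=> ? ? [].
by rewrite mem_iota /= add0n -leqNgt => ->; rewrite subrr normr0.
Qed.

Lemma closure_not_sigma_lebesgue : ~ sigma_lebesgue Xhat.
Proof.
pose x n : Xhat := fl_of (closure_tail n).
move=> Xhat_sigma.
have x_dec : nonincreasing_seq x.
  move=> m n mn; apply/fl_leP => -[k|p]; rewrite /fl_fun //= ler_nat.
  by case: (leqP n k) => // nk; rewrite (leq_trans mn nk).
have x_inf : infimums (range x) 0.
  split=> [_ [n _ <-]|y yx]; apply/fl_leP => t; rewrite fl_zeroE.
    by case: t => [k|p]; rewrite /fl_fun /=.
  (* At a natural k the indicator of the tail from k + 1 already vanishes; on [nat -> nat] every
     term vanishes, so the term of index 0 will do. *)
  case: t => [k|p].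
    have /fl_leP/(_ (inl k)) : y <= x k.+1 by apply: yx; exists k.+1.
    by rewrite {2}/fl_fun /= ltnn.
  have /fl_leP/(_ (inr p)) : y <= x 0%N by apply: yx; exists 0%N.
  by rewrite {2}/fl_fun.
(* The unit ball with no extra points suffices: x N takes the value 1 at the natural N. *)
have [N _ xN] := Xhat_sigma x x_dec x_inf _ (nbhs_fl_ball [::] 0 ltr01).
have : `|fl_fun (0 : Xhat) (inl N) - fl_fun (x N) (inl N)| < 1.
  by apply: (xN N (leqnn N)); left; exists N.
by rewrite fl_zeroE {1}/fl_fun /= leqnn sub0r normrN normr1 ltxx.
Qed.

End Counterexample.

Theorem proposition2p7 (R : realType) :
  exists (X Xhat : locallySolidType R) (i : {linear X -> Xhat}),
    [/\ hausdorff_space X,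
        is_locally_convex X,
        sigma_lebesgue X,
        is_completion i
      & ~ sigma_lebesgue Xhat].
Proof.
exists (fl_type (almost_constant_fl R)).
exists (fl_type (closure_fl (almost_constant_fl R))).
exists (fl_incl (V := almost_constant_fl R)).
split.
- exact: fl_hausdorff.
- exact: fl_locally_convex.
- exact: almost_constant_sigma_lebesgue.
- exact: fl_incl_completion.
- exact: closure_not_sigma_lebesgue.
Qed.
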